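(* For every even integer $n\ge6$, the antiprism graph on $n$ vertices is not B-factorizable. (For $n=6$ this is the graph of the octahedron.)
   Context: The antiprism graph on $n$ vertices has vertex set $V=\mathbb Z/n\mathbb Z$ and edge set $\{\{i,i+1\}: i\in\mathbb Z/n\}\cup\{\{i,i+2\}: i\in\mathbb Z/n\}$; for $n\ge 6$ it is 4-regular. Let $V$ be a finite set with $|V|$ even. $K=\binom{V}{2}$ is the set of 2-element subsets of $V$. An equal partition of $V$ is an unordered pair $\{H,A\}$ of disjoint subsets with $H\cup A=V$ and $|H|=|A|=|V|/2$; $C=C(V)$ is the set of equal partitions. For $c=\{H,A\}\in C$, $B_c$ is the complete bipartite graph with parts $H$ and $A$. Vectors live in $\mathbb N^{K\cup C}$ with $\mathbb N=\{0,1,2,\dots\}$; $v|_K$ denotes the restriction to coordinates in $K$. For $E\subseteq K$, $\chi_E\in\{0,1\}^K$ is its indicator vector. For $E\subseteq K$ and $c\in C$, $\chi_{E,c}\in\mathbb N^{K\cup C}$ has $K$-components $\chi_E$ and $C$-components equal to the indicator of $c$. $PM(V)=\{\chi_{q,c}: c\in C,\ q\text{ a perfect matching of }B_c\}$. For $\mathcal M\subseteq\mathbb N^{K\cup C}$, $\mathbf N(\mathcal M)$ is the set of finite nonnegative integer combinations of elements of $\mathcal M$, and $\overline{\mathbf N}(\mathcal M)=\{v\in\mathbb N^{K\cup C}: kv\in\mathbf N(\mathcal M)\text{ for some integer }k\ge1\}$. A regular graph $G=(V,E)$ is B-factorizable if every $v\in\overline{\mathbf N}(PM(V))$ with $v|_K=\chi_E$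 belongs to $\mathbf N(PM(V))$. *)

(* Defs.v *)
From HB Require Import structures.
From mathcomp Require Import all_boot.
Set Implicit Arguments. Unset Strict Implicit. Unset Printing Implicit Defensive.

Definition Kset (T : finType) := {e : {set T} | #|e| == 2}.

Definition is_eqpart (T : finType) (P : {set {set T}}) : bool :=
  [exists H : {set T}, (P == [set H; ~: H]) && (#|H|.*2 == #|T|)].

Definition Cset (T : finType) := {P : {set {set T}} | is_eqpart P}.

Definition vec (T : finType) := {ffun (Kset T + Cset T)%type -> nat}.

Definition chi_qc (T : finType) (q : {set Kset T}) (c : Cset T) : vec T :=
  [ffun x => match x with
             | inl e => nat_of_bool (e \in q)
             | inr c' => nat_of_bool (c' == c)
             end].

(* e is an edge of the complete bipartite graph B_c: it meets each part once *)
Definition crosses (T : finType) (c : Cset T) (e : Kset T) : bool :=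
  [forall X in val c, #|val e :&: X| == 1].

Definition perfect_matching_B (T : finType) (c : Cset T) (q : {set Kset T}) : bool :=
  [forall e in q, crosses c e] &&
  [forall x : T, #|[set e in q | x \in val e]| == 1].

Definition in_PM (T : finType) (v : vec T) : Prop :=
  exists (c : Cset T) (q : {set Kset T}), perfect_matching_B c q /\ v = chi_qc q c.

(* N(M): finite nonnegative integer combinations (a finite list with repetitions) *)
Definition in_N (T : finType) (M : vec T -> Prop) (v : vec T) : Prop :=
  exists s : seq (vec T), (forall m, m \in s -> M m) /\
    v = [ffun x => \sum_(m <- s) m x].

Definition in_Nbar (T : finType) (M : vec T -> Prop) (v : vec T) : Prop :=
  exists k : nat, 0 < k /\ in_N M [ffun x => k * v x].

Definition B_factorizable (T : finType) (E : pred {set T}) : Prop :=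
  forall v : vec T, in_Nbar (@in_PM T) v ->
    (forall e : Kset T, v (inl e) = nat_of_bool (E (val e))) ->
    in_N (@in_PM T) v.

Definition antiprism_edge (n : nat) : pred {set 'I_n} :=
  fun e => [exists i : 'I_n, exists j : 'I_n,
     (e == [set i; j]) &&
     ((nat_of_ord j == (i + 1) %% n) || (nat_of_ord j == (i + 2) %% n))].
Arguments antiprism_edge n : clear implicits.

(* Main.v *)
Require Import Defs.
From mathcomp Require Import all_boot.
From mathcomp Require Import all_algebra.
From mathcomp Require Import zify ring.

Set Implicit Arguments. Unset Strict Implicit. Unset Printing Implicit Defensive.

(** In a decomposition of the antiprism graph into perfect matchings, call a
    block at x the pair of long edges {x, x+2}, {x+1, x+3}. A matching using
    {x, x+2} must match x+1 to x-1 or x+3, so it contains the block at x or the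
    one at x-1, and exactly one of these alternatives holds for each x. Hence
    the blocks that occur start at all vertices of one parity b, and then all
    short edges {x, x+1} with x of the other parity lie in a single matching.

    Fractionally, b can be split evenly. Colour the vertices by t with 4 colours
    so that t (x + 2) <> t x; for each parity b and colour j let M b j be the
    matching consisting of the blocks at the x of parity b with t x = j, completed
    by short edges starting at parity b. These eight matchings cover every edge
    twice. A union of two perfect matchings is bipartite, so M false j and
    M true j are compatible with a common equal partition c_j, and
    v = chi_E + sum_j chi_(c_j) is in the saturation. An isolated block of colour
    j at x (neither x-1 nor x+1 has colour j) puts x and x+1 on the same side of
    c_j. For n >= 8, t can be chosen with such a block in each colour and each
    parity, so no c_j admits all the short edges of one parity. For n = 6
    this fails, but there both the matching of short edges and the one with a
    suitable block are only admitted by the same c_j, which is available once. *)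

(** * Perfect matchings as fixed-point-free involutions, equal partitions as two-colourings *)

Section Matchings.
Variable T : finType.
Implicit Types (x y : T) (f g : T -> T) (e : Kset T) (c : Cset T).

(** Along an alternating cycle of the two matchings [h] moves by two steps, so the cycle splits into
    two orbits of [h], exchanged by [f] and by [g]. The colour compares the orbit of [x] with that
    of [f x]. *)
Lemma two_matchings_bicolour f g :
  involutive f -> involutive g -> (forall x, f x != x) -> (forall x, g x != x) ->
  exists col : T -> bool, forall x, (col (f x) = ~~ col x) /\ (col (g x) = ~~ col x).
Proof.
move=> fK gK f_neq g_neq; pose h x := f (g x).
have h_inj : injective h by move=> x y /(inv_inj fK)/(inv_inj gK).
have h_sym : connect_sym (frel h) := fconnect_sym h_inj.
have iterK k x : iter k h (f (iter k h x)) = f x.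
  elim: k => [|k IHk] //; rewrite iterSr -[RHS]IHk iterS.
  by rewrite {2 3}/h fK gK.
have iter_h_inj k : injective (iter k h).
  by elim: k => [|k IHk] x y //= /h_inj/IHk.
have h_disc x : ~~ fconnect h x (f x).
  (* Halving the path from [x] to [f x] gives [z = iter k./2 h x] with [h z = f z] or [z = f z], so
     [g] or [f] would fix [z]. *)
  apply/negP=> /iter_findex; move: (findex _ _ _) => k Ek.
  have Ekl : k = k./2 + (odd k + k./2) by rewrite addnCA addnn odd_double_half.
  move: Ek; rewrite Ekl iterD -[in RHS](iterK k./2 x) iterD.
  move/(iter_h_inj k./2); case: (odd k) => /= [|].
    by move/(inv_inj fK)/eqP; rewrite (negPf (g_neq _)).
  by move/eqP; rewrite eq_sym (negPf (f_neq _)).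
have h_f x y : fconnect h x y -> fconnect h (f x) (f y).
  move/iter_findex; move: (findex _ _ _) => k <-.
  by rewrite h_sym -(iterK k x) fconnect_iter.
pose r x := enum_rank (froot h x).
have r_eq x y : fconnect h x y -> r x = r y.
  by move/(fingraph.rootP h_sym); rewrite /r => ->.
have r_neq x : r x != r (f x).
  apply: contra (h_disc x) => /eqP/enum_rank_inj E.
  by apply/(fingraph.rootP h_sym).
exists (fun x => r x < r (f x)) => x; split.
  by rewrite fK -leqNgt ltn_neqAle eq_sym r_neq.
have -> : r (f (g x)) = r x by apply/esym/r_eq/fconnect1.
have -> : r (g x) = r (f x).
  by rewrite -[g x]fK; apply/esym/r_eq/h_f/fconnect1.
by rewrite -leqNgt ltn_neqAle eq_sym r_neq.
Qed.

Lemma set2_eq x y a b :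
  ([set x; y] == [set a; b]) = (x == a) && (y == b) || (x == b) && (y == a).
Proof.
apply/eqP/idP=> [E | /orP[] /andP[/eqP-> /eqP->] //]; last by rewrite setUC.
have := set22 a b; have := set21 a b; rewrite -E !inE.
have := set22 x y; have := set21 x y; rewrite E !inE !(eq_sym a) !(eq_sym b).
by do 4!case: (_ == _).
Qed.

Lemma Kset_pair e : exists x y, x != y /\ val e = [set x; y].
Proof. by case: e => e /= /cards2P. Qed.

Lemma pair_Kset x y : x != y -> exists e, val e = [set x; y].
Proof.
move=> nxy; have E : #|[set x; y]| == 2 by rewrite cards2 nxy.
by exists (Sub [set x; y] E : Kset T).
Qed.

Lemma crosses_colour (col : pred T) c e x y :
    val c = [set [set z | col z]; ~: [set z | col z]] -> val e = [set x; y] ->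
  x != y -> crosses c e = (col x != col y).
Proof.
move=> Ec Ee nxy; rewrite /crosses Ec Ee.
have card_int (A : {set T}) : #|[set x; y] :&: A| = (x \in A) + (y \in A).
  rewrite setIUl cardsU.
  have card1 z : #|[set z] :&: A| = (z \in A).
    case: (boolP (z \in A)) => zA; first by rewrite (setIidPl _) ?sub1set ?cards1.
    by apply/eqP; rewrite cards_eq0 setI_eq0 disjoints1.
  rewrite !card1 setIACA setIid (_ : [set x] :&: [set y] = set0) ?set0I ?cards0 ?subn0 //.
  by apply/eqP; rewrite setI_eq0 disjoints1 inE.
apply/forall_inP/idP=> [/(_ [set z | col z] (set21 _ _)) | col_xy X].
  by rewrite card_int !inE; do 2!case: (col _).
rewrite !inE => /orP[] /eqP->; rewrite card_int !inE; move: col_xy; by do 2!case: (col _).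
Qed.

(** [f] exchanges the two colour classes, so they have the same size. *)
Lemma colour_eqpart f (col : pred T) :
    involutive f -> (forall x, col (f x) = ~~ col x) ->
  exists c, val c = [set [set z | col z]; ~: [set z | col z]].
Proof.
move=> fK fcol; set H := [set z | col z].
suff E : is_eqpart [set H; ~: H] by exists (Sub [set H; ~: H] E : Cset T).
apply/existsP; exists H; rewrite eqxx /= -(cardsC H) -addnn eqn_add2l.
rewrite -(card_imset (mem H) (inv_inj fK)); apply/eqP/eq_card=> x.
apply/imsetP/idP=> [[y] | ]; rewrite !inE.
  by move=> Hy ->; rewrite fcol Hy.
by move=> Hx; exists (f x); rewrite ?inE ?fcol.
Qed.

Definition involution_edges f : {set Kset T} :=
  [set e | [exists x, val e == [set x; f x]]].

Lemma in_involution_edges f e x y :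
  involutive f -> val e = [set x; y] -> (e \in involution_edges f) = (f x == y).
Proof.
move=> fK Ee; rewrite inE Ee; apply/existsP/eqP=> [[z] | <-]; last by exists x.
by rewrite set2_eq => /orP[] /andP[/eqP-> /eqP->].
Qed.

Lemma involution_perfect f (col : pred T) c :
    involutive f -> (forall x, col (f x) = ~~ col x) ->
    val c = [set [set z | col z]; ~: [set z | col z]] ->
  perfect_matching_B c (involution_edges f).
Proof.
move=> fK fcol Ec.
have f_neq x : x != f x by apply/eqP=> E; have := fcol x; rewrite -E; case: (col x).
apply/andP; split.
  apply/forall_inP=> e; rewrite inE => /existsP[x /eqP Ee].
  by rewrite (crosses_colour Ec Ee) // fcol; case: (col x).
apply/forallP=> x; have [e Ee] := pair_Kset (f_neq x); apply/cards1P; exists e.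
apply/setP=> e'; rewrite !inE; apply/andP/eqP=> [[/existsP[z /eqP Ez]] | ->].
  rewrite Ez !inE => xz; apply/val_inj; rewrite /= Ee Ez; case/orP: xz => /eqP-> //.
  by rewrite fK setUC.
by split; [apply/existsP; exists x; rewrite Ee | rewrite Ee set21].
Qed.

(** Each vertex lies in exactly one edge of [q]; [f] sends it to the other end of that edge. *)
Lemma perfect_matching_partner c (q : {set Kset T}) :
    perfect_matching_B c q ->
  exists f, [/\ involutive f, forall x, f x != x
    & forall x y e, val e = [set x; y] -> (e \in q) = (f x == y)].
Proof.
case/andP=> _ /forallP q1.
have /fin_all_exists[f fP] x : exists y, x != y /\ exists e,
    [/\ e \in q, val e = [set x; y] & forall e', e' \in q -> x \in val e' -> e' = e].
  have /cards1P[e /setP Ee] := q1 x.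
  have: e \in [set e in q | x \in val e] by rewrite Ee set11.
  rewrite inE => /andP[qe xe].
  have e1 e' : e' \in q -> x \in val e' -> e' = e.
    by move=> qe' xe'; apply/eqP; have := Ee e'; rewrite !inE qe' xe' /= => <-.
  have [a [b [nab Eab]]] := Kset_pair e.
  move: xe; rewrite Eab !inE => /orP[] /eqP Ex; subst x.
    by exists b; split=> //; exists e.
  by exists a; rewrite eq_sym; split=> //; exists e; split=> //; rewrite Eab setUC.
exists f; split=> [x | x | x y e Ee].
- have [_ [e [qe Ee _]]] := fP x; have [_ [e' [_ Ee' e'1]]] := fP (f x).
  have := e'1 e qe; rewrite Ee set22 => /(_ isT) E; move: Ee'; rewrite -E Ee => /eqP.
  rewrite set2_eq => /orP[/andP[/eqP E1 /eqP E2]|/andP[/eqP <- _] //].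
  by rewrite -E2 -E1.
- by rewrite eq_sym; case: (fP x).
have [nx [e' [qe' Ee' e'1]]] := fP x; apply/idP/eqP=> [qe | Ey].
  have := e'1 e qe; rewrite Ee set21 => /(_ isT) E; move: Ee'; rewrite -E Ee => /eqP.
  by rewrite set2_eq eqxx (negPf nx) /= orbF => /eqP.
by rewrite (_ : e = e') //; apply/val_inj; rewrite /= Ee Ee' Ey.
Qed.

Lemma in_N_family (v : vec T) :
    in_N (@in_PM T) v ->
  exists (I : finType) (c : I -> Cset T) (q : I -> {set Kset T}),
    (forall i, perfect_matching_B (c i) (q i)) /\
    (forall z, v z = \sum_i chi_qc (q i) (c i) z).
Proof.
case=> s [sM ->].
have /fin_all_exists[c /fin_all_exists[q cqP]] (i : 'I_(size s)) :
    in_PM (tnth (in_tuple s) i) by apply/sM/mem_tnth.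
exists 'I_(size s), c, q; split=> [i | z]; first by case: (cqP i).
by rewrite ffunE big_tnth; apply: eq_bigr => i _; case: (cqP i) => _ <-.
Qed.

End Matchings.

(* The values at 0, ..., 7 are 0 2 1 3 2 0 3 1; from 8 on, the even places
   alternate between 2 and 1 and the odd places between 3 and 1, which closes up
   properly on every cycle of even length n >= 8. *)
Definition colour8 k :=
  if odd k then
    if k == 1 then 2 else if k == 3 then 3 else if k == 5 then 0 else
    if k %% 4 == 3 then 1 else 3
  else
    if k == 0 then 0 else if k == 6 then 3 else if k %% 4 == 0 then 2 else 1.

(** * Arithmetic modulo the even number [m.+2] and adjacency in the antiprism *)

Section Antiprism.
Variable m : nat.
Hypothesis m_ge4 : 4 <= m.
Notation T := 'I_m.+2.
Implicit Types x y : T.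
Local Open Scope ring_scope.
Import GRing.Theory.

Lemma val_natr k : ((k%:R : T) : nat) = (k %% m.+2)%N.
Proof. by rewrite Zp_nat. Qed.

(** Since [m.+2 >= 6], none of 1, ..., 5 vanishes modulo [m.+2]. This refutes all coincidences of
    nearby vertices below. *)
Lemma addr_natr_eq k x y : (0 < k < 6)%N -> y = x + k%:R -> (y == x) = false.
Proof.
move=> /andP[k0 k6] ->; apply/negbTE; rewrite -subr_eq0 [x + _]addrC addrK.
by apply/eqP=> /(congr1 val); rewrite /= val_natr modn_small //=; lia.
Qed.

Hypothesis m_even : ~~ odd m.

Lemma odd_add1 x : odd ((x + 1)%R : T) = ~~ odd x.
Proof.
have -> : ((x + 1)%R : T) = ((x + 1) %% m.+2)%N :> nat by rewrite /= (@modn_small 1).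
rewrite addn1; have := ltn_ord x; rewrite leq_eqVlt => /orP[/eqP E|lt].
  by case: E => ->; rewrite modnn /= negbK (negbTE m_even).
by rewrite modn_small.
Qed.

Lemma antiprism_edgeE x y :
  antiprism_edge m.+2 [set x; y] = [|| y == x + 1, y == x + 2, x == y + 1 | x == y + 2].
Proof.
have valD k (i j : T) : (k < m.+2)%N -> (val j == (val i + k) %% m.+2)%N = (j == i + k%:R).
  by move=> k_lt; rewrite -val_eqE /= val_natr (modn_small k_lt).
have val1 (i j : T) : (val j == (val i + 1) %% m.+2)%N = (j == i + 1) by apply: (valD 1%N).
have val2 (i j : T) : (val j == (val i + 2) %% m.+2)%N = (j == i + 2).
  by apply: (valD 2%N); lia.
apply/existsP/idP=> [[i /existsP[j]] | xy].
  rewrite val1 val2 set2_eq => /andP[/orP[] /andP[/eqP-> /eqP->] /orP[] ->];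
  by rewrite ?orbT.
have {xy} /orP[xy|xy] : (y == x + 1) || (y == x + 2) || ((x == y + 1) || (x == y + 2)).
- by rewrite -orbA.
- by exists x; apply/existsP; exists y; rewrite eqxx val1 val2.
by exists y; apply/existsP; exists x; rewrite setUC eqxx val1 val2.
Qed.

(** * Structure of a partition of the antiprism edges into perfect matchings *)

Section Factorization.
Variables (I : finType) (f : I -> T -> T).
Hypotheses (fK : forall i, involutive (f i)) (f_neq : forall i x, f i x != x).
Hypothesis f_edge : forall x y, x != y ->
  (\sum_i (f i x == y) = antiprism_edge m.+2 [set x; y])%N.

Lemma factor_unique i j x : f i x = f j x -> i = j.
Proof.
move=> Eij; apply/eqP/negPn/negP=> nij.
have := f_edge (y := f j x) (x := x); rewrite eq_sym f_neq => /(_ isT).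
rewrite (bigD1 i) //= (bigD1 j) 1?eq_sym //= Eij eqxx; case: (antiprism_edge _ _) => //; lia.
Qed.

Lemma factor_adj i x : [\/ f i x = x + 1, f i x = x + 2, f i x = x - 1 | f i x = x - 2].
Proof.
have: antiprism_edge m.+2 [set x; f i x].
  have := f_edge (y := f i x) (x := x); rewrite eq_sym f_neq => /(_ isT).
  by rewrite (bigD1 i) //= eqxx; case: antiprism_edge.
rewrite antiprism_edgeE => /or4P[] E.
- exact/Or41/eqP.
- exact/Or42/eqP.
- by apply/Or43/eqP; rewrite eq_sym subr_eq.
by apply/Or44/eqP; rewrite eq_sym subr_eq.
Qed.

Lemma factor_exists x y : antiprism_edge m.+2 [set x; y] -> x != y -> exists i, f i x = y.
Proof.
move=> xy /f_edge; rewrite xy => S1; case: (pickP (fun i => f i x == y)) => [i /eqP|none].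
  by exists i.
by move: S1; rewrite big1 // => i _; rewrite none.
Qed.

Lemma factor_step1 x : exists i, f i x = x + 1.
Proof.
apply: factor_exists; first by rewrite antiprism_edgeE eqxx.
by rewrite eq_sym (@addr_natr_eq 1).
Qed.

Lemma factor_step2 x : exists i, f i x = x + 2.
Proof.
apply: factor_exists; first by rewrite antiprism_edgeE eqxx orbT.
by rewrite eq_sym (@addr_natr_eq 2).
Qed.

Definition block i x := (f i x = x + 2) /\ (f i (x + 1) = x + 3).

(** The neighbours [x] and [x + 2] of [x + 1] are matched to each other, which leaves it [x + 3] or
    [x - 1]. *)
Lemma block_or i x : f i x = x + 2 -> block i x \/ block i (x - 1).
Proof.
move=> E2; case: (factor_adj i (x + 1)) => E.
- have /eqP: f i (f i x) = f i (f i (x + 1)) by rewrite E E2; congr f; ring.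
  by rewrite !fK eq_sym (@addr_natr_eq 1).
- by left; split=> //; rewrite E; ring.
- have /eqP: x + 1 = x + 2; last by rewrite eq_sym (@addr_natr_eq 1) //; ring.
  by rewrite -E2 -(fK i (x + 1)) E; congr f; ring.
right; split; last by rewrite subrK E2; ring.
by rewrite (_ : x - 1 = f i (x + 1)) ?fK ?E; ring.
Qed.

(** Both blocks contain the edge {x+1, x+3}, so [i = j]; then [x + 2] would have both [x] and
    [x + 4] as partner. *)
Lemma block_alternates i j x : block i x -> block j (x + 1) -> False.
Proof.
move=> [E2 E3] [E3']; have -> : x + 1 + 1 = x + 2 by ring.
have <- : i = j by apply: (@factor_unique _ _ (x + 1)); rewrite E3 E3'; ring.
by rewrite -E2 fK => /esym/eqP; rewrite (@addr_natr_eq 4) //; ring.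
Qed.

Lemma block_parity : exists b, forall x, odd x = b -> exists i, block i x.
Proof.
pose u x := [exists i, (f i x == x + 2) && (f i (x + 1) == x + 3)].
have uP x : reflect (exists i, block i x) (u x).
  apply: (iffP existsP) => [[i /andP[/eqP E2 /eqP E3]]|[i [E2 E3]]]; exists i => //.
  by rewrite E2 E3 !eqxx.
(* Both cannot hold by [block_alternates]. One does, because the matching with the long edge {x+1,
   x+3} has a block at [x + 1] or at [x]. *)
have u_step x : u (x + 1) = ~~ u x.
  have [[i ui]|nu] := uP x; have [[j uj]|nu'] := uP (x + 1) => //.
    by case: (block_alternates ui uj).
  have [i /block_or[ui | ui]] := factor_step2 (x + 1); first by case: nu'; exists i.
  by case: nu; exists i; rewrite addrK in ui.
have u_nat k : u k%:R = u 0 (+) odd k.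
  elim: k => [|k IHk]; first by rewrite addbF.
  by rewrite -natr1 u_step IHk /= -addbN.
exists (~~ u 0) => x; rewrite -[x in u x]natr_Zp => xb.
by apply/uP; rewrite -[x]natr_Zp u_nat xb addbN addbb.
Qed.

(** The block at [x + 1] puts {x+2, x+4} into the matching of {x+1, x+3}, which is not [f i]. As [x]
    and [x + 1] are taken, only [x + 3] remains for [x + 2]. *)
Lemma short_step b : (forall x, odd x = b -> exists i, block i x) ->
  forall i x, odd x = ~~ b -> f i x = x + 1 -> f i (x + 2) = x + 3.
Proof.
move=> blockb i x xb E1.
have [j [E3 E4]] : exists j, block j (x + 1).
  by apply: blockb; rewrite odd_add1 xb negbK.
have E3' : x + 1 + 2 = x + 3 by ring.
have E2' : x + 1 + 1 = x + 2 by ring.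
have E4' : x + 1 + 3 = x + 4 by ring.
rewrite {}E3' {}E2' {}E4' in E3 E4.
case: (factor_adj i (x + 2)) => E.
- by rewrite E; ring.
- have Eij : i = j by apply: (@factor_unique _ _ (x + 2)); rewrite E E4; ring.
  rewrite -Eij in E3; move: (f_neq i (x + 1)).
  have /eqP : x = x + 3 by rewrite -E3 -E1 fK.
  by rewrite eq_sym (@addr_natr_eq 3) //; ring.
- have /eqP : x + 2 = x by apply: (inv_inj (fK i)); rewrite E E1; ring.
  by rewrite (@addr_natr_eq 2) //; ring.
have /eqP : x + 2 = x + 1; last by rewrite (@addr_natr_eq 1) //; ring.
by rewrite -E1 -[LHS](fK i) E; congr f; ring.
Qed.

Lemma factorization_shape : exists b,
  (forall x, odd x = b -> exists i, block i x) /\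
  (exists i, forall x, odd x = ~~ b -> f i x = x + 1).
Proof.
have [b blockb] := block_parity; exists b; split=> //.
(* Start at the vertex 0 or 1 of parity [~~ b] and advance by 2. *)
have [i Ei] := factor_step1 (nat_of_bool (~~ b))%:R; exists i => x xb.
rewrite -[x]natr_Zp -(odd_double_half x) xb; move: (x./2) => k.
have odd_k k' : odd ((~~ b + k'.*2)%:R : T) = ~~ b.
  rewrite -[RHS](oddb (~~ b)) -[RHS]addbF -(odd_double k') -oddD.
  elim: (~~ b + k'.*2)%N => [|l IHl] //.
  by rewrite -natr1 odd_add1 IHl.
elim: k => [|k IHk]; first by rewrite addn0.
have -> : ((~~ b + k.+1.*2)%:R : T) = (~~ b + k.*2)%:R + 2.
  by rewrite doubleS !addnS -!natr1; ring.
by rewrite (short_step blockb _ IHk) ?odd_k //; ring.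
Qed.

End Factorization.

(* The involution of M b j: y is the vertex of parity b among x - 1, x, where
   the cell {y, y + 1} containing x starts. *)
Definition tiling (t : T -> nat) b j x : T :=
  let y := if odd x == b then x else x - 1 in
  if t y == j then x + 2 else
  if t (y - 2) == j then x - 2 else
  if odd x == b then x + 1 else x - 1.

(** * The eight matchings, their common partitions and the test vector *)

Section Tilings.
Variable t : T -> nat.
Hypotheses (t_lt4 : forall x, (t x < 4)%N) (t_proper : forall x, t (x + 2) != t x).

Lemma odd_sub1 x : odd ((x - 1)%R : T) = ~~ odd x.
Proof. by rewrite -[in RHS](subrK 1 x) odd_add1 negbK. Qed.

Lemma odd_add2 x : odd ((x + 2)%R : T) = odd x.
Proof. by rewrite -[RHS]negbK -!odd_add1; congr (odd (nat_of_ord _)); ring. Qed.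

Lemma odd_sub2 x : odd ((x - 2)%R : T) = odd x.
Proof. by rewrite -odd_add2 subrK. Qed.

(** By [t_proper], blocks of one colour never start at both [y] and [y + 2], so the blocks of one
    matching are disjoint. *)
Lemma tilingK b j : involutive (tiling t b j).
Proof.
move=> x; pose y := if odd x == b then x else x - 1.
rewrite [tiling t b j x]/tiling -/y.
case: ifP => [ty|nty].
  rewrite /tiling odd_add2.
  have -> : (if odd x == b then x + 2 else x + 2 - 1) = y + 2.
    by rewrite /y; case: ifP => // _; ring.
  by rewrite addrK ty -(eqP ty) (negPf (t_proper y)) addrK.
case: ifP => [ty|nty'].
  rewrite /tiling odd_sub2.
  have -> : (if odd x == b then x - 2 else x - 2 - 1) = y - 2.
    by rewrite /y; case: ifP => // _; ring.
  by rewrite ty subrK.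
rewrite /tiling; move: nty nty'; rewrite {}/y; case: ifP => [xb|xb] nty nty'.
  by rewrite odd_add1 -(eqP xb); case: (odd x) xb => /= _; rewrite addrK nty nty'.
have -> : odd ((x - 1)%R : T) == b by rewrite odd_sub1; case: (odd x) b xb => [] [].
by rewrite nty nty' subrK.
Qed.

(** Here [u] and [w] stand for the colours of the cell of a vertex and of the preceding cell; the
    two remaining colours give the short edge. *)
Lemma sum_ord4_if (u w A B C : nat) : (u < 4)%N -> (w < 4)%N -> u != w ->
  (\sum_(j < 4) (if u == j then A else if w == j then B else C) = A + B + C.*2)%N.
Proof.
rewrite !big_ord_recr big_ord0 /=.
by do 4?[case: u => [|u] //]; do 4?[case: w => [|w] //]; move=> /= _ _ _; lia.
Qed.

Lemma tiling_count x y :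
  (\sum_(p : bool * 'I_4) (tiling t p.1 p.2 x == y) =
   2 * ((y == x + 1)%R + (y == x + 2)%R + (x == y + 1)%R + (x == y + 2)%R))%N.
Proof.
rewrite -(pair_bigA _ (fun b (j : 'I_4) => nat_of_bool (tiling t b j x == y))) /=.
rewrite big_bool /=.
have t_sub2 z : t z != t (z - 2) by rewrite -{1}[z](subrK 2) t_proper.
(* For one parity, each long edge is covered once and each short edge starting at that parity
   twice. *)
have row b : (\sum_(j < 4) (tiling t b j x == y) =
    (y == x + 2)%R + (x == y + 2)%R + ((if odd x == b then (y == x + 1)%R else (x == y + 1)%R) : bool).*2)%N.
  pose z := if odd x == b then x else x - 1.
  rewrite -(sum_ord4_if _ _ _ (t_lt4 z) (t_lt4 (z - 2)) (t_sub2 z)); apply: eq_bigr => j _.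
  rewrite /tiling -/z; case: ifP => _; first by rewrite eq_sym.
  case: ifP => _; first by rewrite subr_eq.
  by case: ifP => _; rewrite 1?eq_sym // eq_sym subr_eq.
by rewrite !row; case: (odd x) => /=; lia.
Qed.

Lemma antiprism_edge_count x y : 
  antiprism_edge m.+2 [set x; y] = 
   ((y == x + 1)%R + (y == x + 2)%R + (x == y + 1)%R + (x == y + 2)%R)%N :> nat.
Proof.
have neq k (u v : T) : (0 < k < 6)%N -> v = u + k%:R -> (u == v) = false.
  by move=> k6 E; rewrite eq_sym (addr_natr_eq k6 E).
rewrite antiprism_edgeE; have [->|_] := eqVneq y (x + 1).
  by rewrite !(neq 1%N (x + 1) (x + 2), neq 2%N x (x + 1 + 1), neq 3%N x (x + 1 + 2)) //; ring.
have [->|_] := eqVneq y (x + 2).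
  by rewrite !(neq 3%N x (x + 2 + 1), neq 4%N x (x + 2 + 2)) //; ring.
have [->|_] := eqVneq x (y + 1); last by case: eqP.
by rewrite (neq 1%N (y + 1) (y + 2)) //; ring.
Qed.

Lemma tiling_neq b j x : tiling t b j x != x.
Proof.
pose y := if odd x == b then x else x - 1; rewrite /tiling -/y.
case: ifP => _; first by rewrite (@addr_natr_eq 2).
case: ifP => _; first by rewrite eq_sym (@addr_natr_eq 2) // subrK.
by case: ifP => _; [rewrite (@addr_natr_eq 1) | rewrite eq_sym (@addr_natr_eq 1) // subrK].
Qed.

Lemma tiling_colours : exists (c : 'I_4 -> Cset T) (col : 'I_4 -> pred T),
  (forall j, val (c j) = [set [set z | col j z]; ~: [set z | col j z]]) /\
  (forall j b x, col j (tiling t b j x) = ~~ col j x).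
Proof.
have /fin_all_exists[c /fin_all_exists[col cP]] (j : 'I_4) :
    exists (c : Cset T) (col : pred T),
    val c = [set [set z | col z]; ~: [set z | col z]] /\
    (forall b x, col (tiling t b j x) = ~~ col x).
  have [col colP] := two_matchings_bicolour (tilingK false j) (tilingK true j)
    (tiling_neq false j) (tiling_neq true j).
  have [x|c Ec] := colour_eqpart (col := col) (tilingK false j); first by case: (colP x).
  by exists c, col; split=> // - [] x; case: (colP x).
by exists c, col; split=> [j | j]; case: (cP j).
Qed.

(** Tests the definition on chi_E + sum_j chi_(c_j). The fourth clause says that the [d i] are the
    [c j] with multiplicity, the fifth that a matching joins opposite sides of its partition. *)
Lemma factorization_of_B_factorizable (c : 'I_4 -> Cset T) (col : 'I_4 -> pred T) :
    (forall j, val (c j) = [set [set z | col j z]; ~: [set z | col j z]]) ->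
    (forall j b x, col j (tiling t b j x) = ~~ col j x) ->
    B_factorizable (antiprism_edge m.+2) ->
  exists (I : finType) (d : I -> Cset T) (f : I -> T -> T),
  [/\ forall i, involutive (f i), forall i x, f i x != x,
      forall x y, x != y -> (\sum_i (f i x == y) = antiprism_edge m.+2 [set x; y])%N,
      forall c', (\sum_i (c' == d i) = \sum_j (c' == c j))%N
    & forall i j x, d i = c j -> col j (f i x) != col j x].
Proof.
move=> cE colt Bfact.
pose v : vec T := [ffun z => match z with
  | inl e => nat_of_bool (antiprism_edge m.+2 (val e))
  | inr c' => (\sum_(j < 4) (c' == c j))%N
  end].
have v_sat : in_Nbar (@in_PM T) v.
  (* Twice [v] is the sum of the eight tilings, each taken with the partition of its colour. *)
  exists 2; split=> //.
  exists [seq chi_qc (involution_edges (tiling t p.1 p.2)) (c p.2) | p : bool * 'I_4].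
  split=> [_ /imageP[[b j] _ ->] | ].
    exists (c j), (involution_edges (tiling t b j)); split=> //.
    exact: (involution_perfect (tilingK b j) (colt j b)).
  apply/ffunP=> z; rewrite !ffunE big_image /=.
  under eq_bigr => p _ do rewrite ffunE.
  case: z => [e|c'].
    have [x [y [nxy Ee]]] := Kset_pair e.
    under eq_bigr => p _ do rewrite (in_involution_edges (tilingK p.1 p.2) Ee).
    by rewrite Ee antiprism_edge_count tiling_count.
  rewrite -(pair_bigA _ (fun (b : bool) (j : 'I_4) => nat_of_bool (c' == c j))) /=.
  by rewrite big_bool /= addnn mul2n.
have v_edge (e : Kset T) : v (inl e) = nat_of_bool (antiprism_edge m.+2 (val e)).
  by rewrite ffunE.
have [I [d [q [qP vE]]]] := in_N_family (Bfact v v_sat v_edge).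
have /fin_all_exists[f fP] i := perfect_matching_partner (qP i).
have f_neq i x : f i x != x by case: (fP i).
exists I, d, f; split=> // [i | x y nxy | c' | i j x dc].
- by case: (fP i).
- have [e Ee] := pair_Kset nxy; rewrite -Ee -v_edge vE.
  by apply: eq_bigr => i _; rewrite ffunE; case: (fP i) => _ _ /(_ _ _ _ Ee) ->.
- have := vE (inr c'); rewrite ffunE => ->.
  by apply: eq_bigr => i _; rewrite ffunE.
have [e Ee] := pair_Kset (f_neq i x); have [_ _ fq] := fP i.
have/andP[/forall_inP/(_ e) cross _] := qP i.
rewrite -(crosses_colour (cE j) Ee) // -dc cross //.
by rewrite (fq x (f i x)) // Ee setUC.
Qed.

Section Colours.
Variables (j : nat) (col : pred T).
Hypothesis colt : forall b x, col (tiling t b j x) = ~~ col x.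

Lemma colour_block x : t x = j -> col (x + 2) = ~~ col x /\ col (x + 3) = ~~ col (x + 1).
Proof.
move=> tx; split; first by rewrite -(colt (odd x)) /tiling eqxx tx eqxx.
rewrite -(colt (odd x)) /tiling odd_add1 [_ == odd x](_ : _ = false) ?addrK ?tx ?eqxx.
  by congr col; ring.
by case: (odd x).
Qed.

Lemma colour_short x : t x != j -> t (x + 2) != j -> col (x + 3) = ~~ col (x + 2).
Proof.
move=> tx tx2; rewrite -(colt (odd x)) /tiling odd_add2 eqxx addrK (negPf tx) (negPf tx2).
by congr col; ring.
Qed.

(** [x + 3] is opposite to [x + 1] by the block, and to [x + 2] by a short edge of the tiling of the
    other parity. *)
Lemma colour_isolated x : t x != j -> t (x + 1) = j -> t (x + 2) != j ->
  col (x + 2) = col (x + 1).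
Proof.
move=> tx /colour_block[]; have -> : x + 1 + 2 = x + 3 by ring.
by move=> E3 _ /(colour_short tx); rewrite E3 => /negb_inj.
Qed.

End Colours.

(** The isolated block starts at [x + 1]; the shift avoids subtraction. *)
Definition isolated x (j : nat) := [&& t x != j, t (x + 1) == j & t (x + 2) != j].

Lemma isolated_not_factorizable :
    (forall (j : 'I_4) b, exists x, odd ((x + 1)%R : T) = b /\ isolated x j) ->
  ~ B_factorizable (antiprism_edge m.+2).
Proof.
move=> iso; have [c [col [cE colt]]] := tiling_colours.
move=> /(factorization_of_B_factorizable cE colt)[I [d [f [fK f_neq f_edge dc col_f]]]].
have [b [_ [i short]]] := factorization_shape fK f_neq f_edge.
have [j dij] : exists j, d i = c j.
  have := dc (d i); rewrite (bigD1 i) //= eqxx.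
  case: (pickP (fun j => d i == c j)) => [j /eqP|none]; first by exists j.
  by rewrite [RHS]big1 // => j _; rewrite none.
(* The matching [f i] joins [x + 1] to [x + 2], but [c j] has both on one side. *)
have [x [xb /and3P[tx /eqP tx1 tx2]]] := iso j (~~ b).
have := col_f i j (x + 1) dij; rewrite short //.
have := colour_isolated (colt j) tx tx1 tx2.
have -> : x + 1 + 1 = x + 2 by ring.
by move=> -> /eqP[].
Qed.

End Tilings.

(** * Isolated blocks in every colour and parity for at least eight vertices *)

Lemma antiprism_ge8_not_factorizable : (6 <= m)%N -> ~ B_factorizable (antiprism_edge m.+2).
Proof.
move=> m6; pose t x := colour8 x.
have t_lt4 x : (t x < 4)%N by rewrite /t /colour8; do ![case: ifP => //].
have t_proper x : t (x + 2) != t x.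
  have -> : t (x + 2) = colour8 ((x + 2) %% m.+2)%N.
    rewrite /t -[nat_of_ord (x + 2)%R]/((x + (2%:R : T)) %% m.+2)%N val_natr.
    by rewrite (@modn_small 2) //; lia.
  rewrite /t; have := ltn_ord x; move: (nat_of_ord x) => k k_lt.
  have [k2|k2] := ltnP (k + 2) m.+2.
    rewrite modn_small // /colour8; do ![case: ifP => ?]; lia.
  (* The wrap-around cases, where [x + 2] is 0 or 1. *)
  have [->|->] : k = m \/ k = m.+1 by lia.
    by rewrite addn2 modnn /colour8 (negPf m_even); do ![case: ifP => ?] => //; lia.
  have -> : (m.+1 + 2 = m.+2 + 1)%N by lia.
  rewrite modnDl modn_small // /colour8 /= (negPf m_even) /=; do ![case: ifP => ?] => //; lia.
apply: (isolated_not_factorizable t_lt4 t_proper) => j b.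
have t_nat k : t k%:R = colour8 (k %% m.+2) by rewrite /t val_natr.
have iso k (j' : nat) : [&& colour8 (k %% m.+2) != j', colour8 (k.+1 %% m.+2) == j' &
    colour8 (k.+2 %% m.+2) != j'] -> isolated t k%:R j'.
  by rewrite /isolated -!t_nat -!natr1 -addrA -[1 + 1]/(2 : T).
have wit k : isolated t k%:R j -> odd (k.+1 %% m.+2) = b ->
    exists x, odd ((x + 1)%R : T) = b /\ isolated t x j.
  by move=> isoj odd_k; exists k%:R; rewrite natr1 val_natr.
have mod8 : (8 %% m.+2 = if m == 6 then 0 else 8)%N.
  case: eqP => [-> //|m_neq]; rewrite modn_small //; lia.
have small k : (k < 8)%N -> (k %% m.+2 = k)%N by move=> ?; rewrite modn_small //; lia.
have modS : (m.+1 %% m.+2 = m.+1)%N by rewrite modn_small.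
have modSS : (m.+3 %% m.+2 = 1)%N by rewrite -addn1 modnDl modn_small.
(* For the colours 0 to 3, odd parity first, the isolated blocks start at 5, 0; 7, 2; 1, 4; 3, 6.
   The witness is the vertex before; for 0 it is [m.+1]. *)
case: j {t_nat} wit => [[|[|[|[|j]]]] jlt] //= wit; case: b wit => wit.
- by apply: (wit 4); first apply: iso; rewrite !small.
- apply: (wit m.+1); first apply: iso; rewrite ?modnn ?modS ?modSS //=.
  rewrite andbT /colour8 /= (negPf m_even) /=; do ![case: ifP => ?] => //; lia.
- apply: (wit 6); first apply: iso; rewrite ?mod8 !small //.
  by case: ifP.
- by apply: (wit 1%N); first apply: iso; rewrite !small.
- by apply: (wit 0%N); first apply: iso; rewrite !small.
- by apply: (wit 3); first apply: iso; rewrite !small.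
- by apply: (wit 2); first apply: iso; rewrite !small.
by apply: (wit 5); first apply: iso; rewrite !small.
Qed.

End Antiprism.

(** * The octahedron *)

(** Both [d i] and [d i'] are forced to be [c j0], a value then taken at least twice by [d] but only
    once by [c]. *)
Lemma same_value_conflict (U : eqType) (I J : finType) (d : I -> U) (c : J -> U) i i' j0 :
    i != i' -> (forall u, \sum_i (u == d i) = \sum_j (u == c j)) ->
    (forall j, j != j0 -> d i <> c j) -> (forall j, j != j0 -> d i' <> c j) -> False.
Proof.
move=> ni dc ci ci'.
have count i1 : (forall j, j != j0 -> d i1 <> c j) -> \sum_j (d i1 == c j) = (d i1 == c j0).
  move=> ci1; rewrite (bigD1 j0) //= big1 ?addn0 // => j /ci1/eqP.
  by move/negPf->.
have value i1 : (forall j, j != j0 -> d i1 <> c j) -> d i1 = c j0.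
  by move/count; rewrite -dc (bigD1 i1) //= eqxx; case: eqP.
have := count i ci; rewrite -dc (bigD1 i) //= (bigD1 i') 1?eq_sym //= value // value // !eqxx.
by [].
Qed.

Lemma octahedron_not_factorizable : ~ B_factorizable (antiprism_edge 6).
Proof.
(* Colours 0 and 1 have isolated blocks in both parities, colour 2 only at the even vertex 2, colour
   3 only at the odd vertex 5. *)
pose t (x : 'I_6) := nth 0 [:: 1; 0; 2; 1; 0; 3] x.
have t_lt4 x : t x < 4 by case: x => [] [|[|[|[|[|[|k]]]]]].
have t_proper x : t (x + 2)%R != t x by case: x => [] [|[|[|[|[|[|k]]]]]].
have [c [col [cE colt]]] := @tiling_colours 4 isT isT t t_proper.
case/(factorization_of_B_factorizable (m := 4) isT isT t_lt4 t_proper cE colt) =>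
  I [d [f [fK f_neq f_edge dc col_f]]].
have [b [blockb [i short]]] := @factorization_shape 4 isT isT I f fK f_neq f_edge.
pose p k : 'I_6 := (k%:R)%R.
have pS k : (p k + 1)%R = p k.+1 by rewrite /p GRing.natr1.
have p2 k : (p k + 2)%R = p k.+2 by rewrite -!pS -GRing.addrA.
have p3 k : (p k + 3)%R = p k.+3 by rewrite -!pS -!GRing.addrA.
have p6 k : p k.+3.+3 = p k by apply: ord_inj; rewrite !val_natr -[k.+3.+3]/(6 + k) modnDl.
have blk (j : 'I_4) k : t (p k) = j ->
    col j (p k.+2) = ~~ col j (p k) /\ col j (p k.+3) = ~~ col j (p k.+1).
  by move=> /(colour_block (m := 4) isT (colt j)); rewrite p2 p3 pS.
have sht (j : 'I_4) k : t (p k) != j -> t (p k.+2) != j ->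
    col j (p k.+3) = ~~ col j (p k.+2).
  by rewrite -p2 -p3; apply: (colour_short (m := 4) isT (colt j)).
have not_iso (j : 'I_4) k : t (p k) != j -> t (p k.+1) = j -> t (p k.+2) != j ->
    odd (p k.+1) = ~~ b -> d i <> c j.
  move=> tk tk1 tk2 pk dj; have := col_f i j (p k.+1) dj; rewrite short // pS.
  have [E _] := blk j k.+1 tk1; have := sht j k tk tk2; rewrite E.
  by move=> /negb_inj -> /eqP[].
have colQ i' j k : block f i' (p k) -> d i' = c j ->
    col j (p k.+2) != col j (p k) /\ col j (p k.+3) != col j (p k.+1).
  by move=> [E2 E3] dj; rewrite -p2 -p3 -E2 -E3 -pS !col_f.
have neq_block i' k : odd (p k) = ~~ b -> block f i' (p k.+1) -> i != i'.
  move=> pk [E2 _]; apply/eqP=> ii; move: E2; rewrite -ii -{1}pS -short // fK p2 -p3.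
  by move/eqP; rewrite eq_sym (@addr_natr_eq 4 isT 3).
(* If blocks start at odd vertices, isolated blocks at 4, 0, 2 exclude [c 0], [c 1], [c 2] for the
   short matching. The matching with the block at 5 is excluded from the same three by their
   colourings, so both need [c 3]. *)
case: b blockb short not_iso neq_block => blockb short not_iso neq_block.
  have [i' blk5] := blockb (p 5) erefl; have := colQ i' _ 5 blk5; rewrite !p6 => Q5.
  apply: (same_value_conflict (j0 := @Ordinal 4 3 isT) (neq_block i' 4 erefl blk5) dc).
    by case=> [] [|[|[|[|j]]]] // jlt _; [apply: (not_iso _ 3) | apply: (not_iso _ 5) | apply: (not_iso _ 1)].
  case=> [] [|[|[|[|j]]]] // jlt _ /Q5[].
  - have [_] := blk (Ordinal jlt) 1 erefl; have [] := blk (Ordinal jlt) 4 erefl.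
    by rewrite !p6; do 5!case: (col _ _).
  - have [] := blk (Ordinal jlt) 3 erefl; have [] := blk (Ordinal jlt) 0 erefl.
    by rewrite !p6; do 6!case: (col _ _).
  have := sht (Ordinal jlt) 3 erefl erefl; have := sht (Ordinal jlt) 4 erefl erefl.
  by rewrite !p6; do 4!case: (col _ _).
(* For even block starts, the isolated blocks at 1, 3, 5 and the block at 2 leave only [c 2] to both
   matchings. *)
have [i' blk2] := blockb (p 2) erefl; have := colQ i' _ 2 blk2; rewrite ?p6 => Q2.
apply: (same_value_conflict (j0 := @Ordinal 4 2 isT) (neq_block i' 1 erefl blk2) dc).
  by case=> [] [|[|[|[|j]]]] // jlt _; [apply: (not_iso _ 0) | apply: (not_iso _ 2) | apply: (not_iso _ 4)].
case=> [] [|[|[|[|j]]]] // jlt _ /Q2[].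
- have [] := blk (Ordinal jlt) 1 erefl; have [] := blk (Ordinal jlt) 4 erefl.
  by rewrite !p6; do 6!case: (col _ _).
- have [] := blk (Ordinal jlt) 3 erefl; have [] := blk (Ordinal jlt) 0 erefl.
  by rewrite !p6; do 6!case: (col _ _).
have := sht (Ordinal jlt) 1 erefl erefl; have := sht (Ordinal jlt) 2 erefl erefl.
by do 4!case: (col _ _).
Qed.

Theorem mainTheorem10 (n : nat) (hn : 6 <= n) (heven : ~~ odd n) :
  ~ B_factorizable (antiprism_edge n).
Proof.
case: n hn heven => [|[|m]] //; rewrite /= negbK !ltnS => m_ge4 m_even.
have [/eqP <-|m_neq4] := boolP (4 == m); first exact: octahedron_not_factorizable.
apply: antiprism_ge8_not_factorizable => //; lia.
Qed.
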